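(* Let $A$ be a circular matrix with $n$ columns, and let $s,p$ be integers with $2\le p\le s-1$. Then $A$ has $C_s^p$ as a circulant minor (i.e. there is $N\subseteq[n]$ with $A/N\approx C_s^p$) if and only if there exists a family $\Gamma=\{\Gamma^i : i\in[a]\}$ of $a=\gcd(s,p)$ pairwise vertex-disjoint circuits in $F(A)$ without bad arcs (that is, no row arc of $F(A)$ is a bad arc with respect to $\Gamma$), each of them having $\frac{s}{a}$ row arcs and winding number $\frac{p}{a}$. Moreover, if $\Gamma$ is such a family, $B$ is the set of essential bullets of $\Gamma$ and $N=[n]\setminus B$, then $A/N\approx C_s^p$.
   Context: For $n\in\mathbb N$, $[n]$ denotes $\{1,\dots,n\}$ with addition modulo $n$. For $x,y\in[n]$, $y-x$ denotes the least integer $t\ge 0$ with $x+t\equiv y \pmod n$; the circular interval is $[x,y]_n=\{x+r : 0\le r\le y-x\}$, and $(x,y]_n=[x,y]_n\setminus\{x\}$, $[x,y)_n=[x,y]_n\setminus\{y\}$. A circular matrix is an $m\times n$ $\{0,1\}$-matrix $A$ such that for every row $i\in[m]$ there are two distinct $\ell_i,u_i\in[n]$ such that row $i$ is the incidence vector of $[\ell_i,u_i]_n$. Row $i$ dominates row $j\ne i$ if the support of row $j$ is contained in the support of row $i$; a row is dominating if it dominates some other row. All circular matrices are assumed to have no dominating rows and no zero rows or columns. Two matrices are isomorphic, written $A\approx A'$, if one is obtained from the other by permuting rows and columns. A circulant matrix is a square circular matrix; all its rows then have the same number $k\ge 2$ of ones. For $2\le k\le n-1$, $C_n^k$ denotes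 the $n\times n$ matrix whose $i$-th row is the incidence vector of $[i,i+k)_n$. For $N\subseteq[n]$, the minor $A/N$ is obtained from $A$ by removing all columns with indices in $N$ and then all dominating rows (among identical rows one copy is kept). A circulant minor is a minor $A/N$ isomorphic to a circulant matrix. $F(A)$ is the directed (multi)graph with vertex set $[n]$ and the following arcs: a row arc $(\ell_i-1,u_i)$ for every row $i\in[m]$; and, for every $j\in[n]$, a reverse short arc $(j,j-1)$ and a forward short arc $(j-1,j)$. Parallel arcs of different types are regarded as distinct. A row arc $(x,y)$ jumps over $j\in[n]$ if $j\in(x,y]_n$. The length of a row arc $(x,y)$ is $y-x$ (the least integer $t\ge 0$ with $x+t\equiv y \pmod n$), that of a forward short arc is $1$, and that of a reverse short arc is $-1$. Circuits are simple directed circuits. The winding number of a circuit is the sum of the lengths of its arcs divided by $n$. For a circuit $\Gamma'$ with arc set $E(\Gamma')$: its circles are the $j$ with forward short arc $(j-1,j)\in E(\Gamma')$, its crosses are the $j$ with reverse short arc $(j,j-1)\in E(\Gamma')$, and its bullets are all other vertices in $[n]$. An essential bullet of $\Gamma'$ is a bullet of $\Gamma'$ that is a vertex of $\Gamma'$. If $\Gamma'$ has winding number $p'$, a row arc of $F(A)$ is a bad arc with respect to $\Gamma'$ if it jumps over exactly $p'-1$ essential bullets of $\Gamma'$. For a family $\Gamma=\{\Gamma^i\}$ of vertex-disjoint circuits, the set of essential bullets of $\Gamma$ is the union of the sets of essential bullets of the $\Gamma^i$, and a row arc of $F(A)$ is a bad arc with respect to $\Gamma$ if it is a bad arc with respect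 to some $\Gamma^i$. *)

(* Defs.v *)
From HB Require Import structures.
From mathcomp Require Import all_boot all_order all_fingroup all_algebra.

Set Implicit Arguments.
Unset Strict Implicit.
Unset Printing Implicit Defensive.

(* The cyclically ordered set [n] = {1, ..., n} is encoded by 'I_n =
   {0, ..., n-1}, its elements being residues modulo n; x + 1 and x - 1 are
   ordS n x and ord_pred n x. *)

Section CircularIntervals.
Variable n : nat.
Implicit Types x y j : 'I_n.

Definition cshift x (r : nat) : 'I_n := iter r (@ordS n) x.

(* the least t >= 0 with x + t = y modulo n *)
Definition cdist x y : nat := (y + n - x) %% n.

(* [x, y]_n, (x, y]_n and [x, y)_n *)
Definition cint_cc x y : {set 'I_n} :=
  [set cshift x r | r : 'I_n & (r <= cdist x y)%N].
Definition cint_oc x y : {set 'I_n} := cint_cc x y :\ x.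
Definition cint_co x y : {set 'I_n} := cint_cc x y :\ y.

End CircularIntervals.

Section ZeroOneMatrices.
Variables m n : nat.
Implicit Type A : 'M[bool]_(m, n).

Definition row_supp A (i : 'I_m) : {set 'I_n} := [set j | A i j].

Definition dominates A (i j : 'I_m) : bool :=
  (i != j) && (row_supp A j \subset row_supp A i).

(* The endpoints l i, u i are part of the data: they are determined by row i
   unless that row is all ones, in which case any l i = u i + 1 is allowed. *)
Definition circular A (l u : 'I_m -> 'I_n) : Prop :=
  [/\ forall i, l i != u i /\ row_supp A i = cint_cc (l i) (u i),
      forall i j, ~~ dominates A i j,
      forall i, exists j, A i j
    & forall j, exists i, A i j].

(* The rows of A / N: those whose support outside N is minimal for inclusion,
   keeping the first one among rows that coincide outside N. *)
Definition minor_rows A (N : {set 'I_n}) : {set 'I_m} :=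
  [set i | [forall j, (row_supp A j :\: N \subset row_supp A i :\: N) ==>
     (row_supp A j :\: N == row_supp A i :\: N) && (i <= j)%N]].

Definition minor A (N : {set 'I_n}) : 'M[bool]_(#|minor_rows A N|, #|~: N|) :=
  mxsub enum_val enum_val A.

End ZeroOneMatrices.

Definition mx_iso m n m' n' (A : 'M[bool]_(m, n)) (A' : 'M[bool]_(m', n')) :
    Prop :=
  exists (e : (m = m') * (n = n')) (f : 'S_m') (g : 'S_n'),
    row_perm f (col_perm g (castmx e A)) = A'.

(* C_n^k; it is only meant for 2 <= k <= n - 1 *)
Definition circulant (n k : nat) : 'M[bool]_n :=
  \matrix_(i, j) (j \in cint_co i (cshift i k)).

Inductive farc (m n : nat) : Type :=
  | RowArc of 'I_m   (* from l i - 1 to u i *)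
  | RevArc of 'I_n   (* from j to j - 1 *)
  | FwdArc of 'I_n   (* from j - 1 to j *).
Arguments RowArc {m n} _.
Arguments RevArc {m n} _.
Arguments FwdArc {m n} _.

Section FarcEq.
Variables m n : nat.

Definition sum_of_farc (e : farc m n) : 'I_m + ('I_n + 'I_n) :=
  match e with
  | RowArc i => inl i | RevArc j => inr (inl j) | FwdArc j => inr (inr j)
  end.
Definition farc_of_sum (z : 'I_m + ('I_n + 'I_n)) : farc m n :=
  match z with
  | inl i => RowArc i | inr (inl j) => RevArc j | inr (inr j) => FwdArc j
  end.
Lemma sum_of_farcK : cancel sum_of_farc farc_of_sum.
Proof. by case. Qed.

HB.instance Definition _ := Equality.copy (farc m n) (can_type sum_of_farcK).

End FarcEq.

Definition is_row_arc m n (e : farc m n) : bool :=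
  if e is RowArc _ then true else false.

(* The digraph F(A), given by the endpoints l, u of the rows of A *)
Section DigraphF.
Variables (m n : nat) (l u : 'I_m -> 'I_n).

Definition farc_tail (e : farc m n) : 'I_n :=
  match e with
  | RowArc i => ord_pred (l i) | RevArc j => j | FwdArc j => ord_pred j
  end.

Definition farc_head (e : farc m n) : 'I_n :=
  match e with
  | RowArc i => u i | RevArc j => ord_pred j | FwdArc j => j
  end.

Definition farc_length (e : farc m n) : int :=
  match e with
  | RowArc i => Posz (cdist (ord_pred (l i)) (u i))
  | RevArc _ => (-1)%R
  | FwdArc _ => 1%R
  end.

Definition jumped (i : 'I_m) : {set 'I_n} :=
  cint_oc (farc_tail (RowArc i)) (farc_head (RowArc i)).

(* A circuit is listed as the sequence of its arcs. *)
Definition circuit (c : seq (farc m n)) : Prop :=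
  [/\ c != [::],
      path.cycle (fun e e' => farc_head e == farc_tail e') c
    & uniq (map farc_tail c)].

Definition circuit_vertices (c : seq (farc m n)) : {set 'I_n} :=
  [set v in map farc_tail c].

(* The division is exact on circuits: the length of an arc is congruent to
   head - tail modulo n. *)
Definition winding (c : seq (farc m n)) : int :=
  ((\sum_(e <- c) farc_length e)%R %/ Posz n)%Z.

Definition circles (c : seq (farc m n)) : {set 'I_n} :=
  [set j | FwdArc j \in c].
Definition crosses (c : seq (farc m n)) : {set 'I_n} :=
  [set j | RevArc j \in c].
Definition bullets (c : seq (farc m n)) : {set 'I_n} :=
  ~: (circles c :|: crosses c).
Definition essential_bullets (c : seq (farc m n)) : {set 'I_n} :=
  bullets c :&: circuit_vertices c.

Definition bad_arc (c : seq (farc m n)) (i : 'I_m) : Prop :=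
  Posz #|jumped i :&: essential_bullets c| = (winding c - 1)%R.

Section Families.
Variables (a : nat) (G : 'I_a -> seq (farc m n)).

Definition disjoint_circuits : Prop :=
  (forall k, circuit (G k)) /\
  (forall k k', k != k' ->
     [disjoint circuit_vertices (G k) & circuit_vertices (G k')]).

Definition family_essential_bullets : {set 'I_n} :=
  \bigcup_(k < a) essential_bullets (G k).

Definition family_bad_arc (i : 'I_m) : Prop := exists k, bad_arc (G k) i.

End Families.

Definition good_family (s p : nat) (G : 'I_(gcdn s p) -> seq (farc m n)) :
    Prop :=
  [/\ disjoint_circuits G,
      forall i, ~ family_bad_arc G i
    & forall k, count (@is_row_arc m n) (G k) = s %/ gcdn s p /\
                winding (G k) = Posz (p %/ gcdn s p)].

End DigraphF.

(* Main.v *)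
Require Import Defs.
From mathcomp Require Import all_boot all_order all_fingroup all_algebra.
From mathcomp Require Import zify.

Set Implicit Arguments.
Unset Strict Implicit.
Unset Printing Implicit Defensive.

Import GRing.Theory.

(** Both sides of the equivalence say the same thing about the set B of columns
    that are kept.  The trace of a row is its support inside B, a cyclic interval
    of B.  A minor A / N with B = ~: N is isomorphic to C_s^p exactly when B has s
    elements, every trace has at least p of them, and every one of the s cyclic
    intervals of p consecutive elements of B is the trace of some row; this is
    [circulant_trace].  Intervals of B of size p < s are told apart by where they
    start ([window_mem]), and the start is recorded by the [block] of the vertex
    from which the row arc departs: the number modulo s of elements of B up to
    it.

    Counting replaces any unrolling of the circle.  In a circuit of F(A) with
    winding number w, the number of its row arcs that jump over a vertex v, plus
    one if v is a circle and minus one if v is a cross, is the net number of times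
    that the circuit passes v; equality of in-degree and out-degree makes it
    independent of v, and summing over v gives w ([flow_winding]).  Similarly, the
    essential bullets in an interval are counted by the heads of row arcs in it,
    up to crosses at its two ends ([card_essential_bullets_oc]).  As no row
    dominates another, the head of i lies in row r if and only if row i jumps over
    the first element of r ([head_jumped]).  Together these give, for every row r
    of A and every circuit,

      bullets jumped by r + [l r is a circle] = w + [u r + 1 is a cross]

    which is [jumped_essential_bullets].

    Given a family, this identity shows that a row that is not bad jumps over at
    least p / a bullets of each circuit, hence over at least p in all, and that the
    rows of the family jump over exactly p.  Those s rows have different traces,
    because the bullets between two of their heads are as many as the heads
    ([card_bullets_between_heads]).

    Given B, choose in each block the first vertex from which some row departs.
    Its row arc leads from block t to block t + p, where short arcs lead on to the
    chosen vertex of that block.  The circuits obtained correspond to the gcd(s, p)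
    orbits of t |-> t + p.  An element of B is neither circle nor cross, so summing
    the flow over B gives s w = (s / a) p.  By the choice of the first
    departure, no row departs from the tail of a forward short arc, so the term
    [l r is a circle] vanishes in the identity and there is no bad arc. *)

(** * Cyclic intervals *)

Section CyclicIntervals.
Variable n : nat.
Implicit Types x y z v w j : 'I_n.

Lemma val_ordS j : ordS j = (if j.+1 == n then 0 else j.+1) :> nat.
Proof.
rewrite /=; case: eqP => [->|ne]; first exact: modnn.
by rewrite modn_small //; have := ltn_ord j; lia.
Qed.

Lemma val_ord_pred j : ord_pred j = (if j == 0 :> nat then n.-1 else j.-1) :> nat.
Proof.
have lt := ltn_ord j; rewrite /=; case: eqP => [->|ne].
  by rewrite add0n modn_small //; lia.
by rewrite (_ : (j + n).-1 = j.-1 + n) ?modnDr ?modn_small //; lia.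
Qed.

Lemma cdistE x y : cdist x y = if x <= y then y - x else y + n - x.
Proof.
have := (ltn_ord x, ltn_ord y); rewrite /cdist => -[ltx lty].
case: (leqP x y) => le; last by rewrite modn_small //; lia.
by rewrite (_ : y + n - x = y - x + n) ?modnDr ?modn_small //; lia.
Qed.

Lemma cdist_lt x y : cdist x y < n.
Proof. by rewrite cdistE; have ltx := ltn_ord x; have lty := ltn_ord y; case: (leqP x y); lia. Qed.

Lemma val_cshift x r : cshift x r = (x + r) %% n :> nat.
Proof.
rewrite /cshift; elim: r => [|r IH] /=; first by rewrite addn0 modn_small.
by rewrite IH -addn1 modnDml addn1 addnS.
Qed.

Lemma cshift_cdist x y : cshift x (cdist x y) = y.
Proof.
apply: val_inj; rewrite /= val_cshift cdistE.
have := (ltn_ord x, ltn_ord y) => -[ltx lty]; case: (leqP x y) => le.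
  by rewrite subnKC // modn_small.
by rewrite (_ : x + _ = y + n) ?modnDr ?modn_small //; lia.
Qed.

Lemma cdist_cshift x r : r < n -> cdist x (cshift x r) = r.
Proof.
move=> ltr; rewrite cdistE val_cshift; have ltx := ltn_ord x.
case: (ltnP (x + r) n) => lt; first by rewrite modn_small //; case: leqP; lia.
rewrite (_ : x + r = x + r - n + n) ?modnDr ?modn_small; try lia.
by case: leqP; lia.
Qed.

Lemma mem_cint_cc x y j : (j \in cint_cc x y) = (cdist x j <= cdist x y).
Proof.
apply/imsetP/idP => [[r /=]|le]; first by rewrite inE => le ->; rewrite cdist_cshift.
by exists (Ordinal (cdist_lt x j)); rewrite ?inE //= cshift_cdist.
Qed.

Lemma cint_ccE x y j :
  (j \in cint_cc x y) = if x <= y then x <= j <= y else (x <= j) || (j <= y).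
Proof.
rewrite mem_cint_cc !cdistE.
have ltx := ltn_ord x; have lty := ltn_ord y; have ltj := ltn_ord j.
by case: (leqP x y); case: (leqP x j); lia.
Qed.

Lemma cint_ocE x y j :
  (j \in cint_oc x y) = if x <= y then x < j <= y else (x < j) || (j <= y).
Proof.
by rewrite in_setD1 cint_ccE -val_eqE /=; case: (leqP x y); lia.
Qed.

Lemma mem_cint_co_cshift x k j : k < n -> (j \in cint_co x (cshift x k)) = (cdist x j < k).
Proof.
move=> ltk; rewrite in_setD1 mem_cint_cc cdist_cshift // ltn_neqAle; congr (~~ _ && _).
by apply/eqP/eqP => [->|<-]; rewrite ?cdist_cshift ?cshift_cdist.
Qed.


Lemma card_cint_oc x y : #|cint_oc x y| = cdist x y.
Proof.
pose f (r : 'I_n) := cshift x r.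
have fI : injective f.
  by move=> r r' /(congr1 (cdist x)); rewrite !cdist_cshift // => /val_inj.
have -> : cint_oc x y = f @: [set r : 'I_n | 0 < r <= cdist x y].
  apply/setP=> j; rewrite in_setD1 mem_cint_cc.
  apply/andP/imsetP => [[ne le]|[r]].
    exists (Ordinal (cdist_lt x j)); rewrite ?inE /= ?le ?andbT; last by rewrite /f cshift_cdist.
    rewrite lt0n; apply: contraNneq ne => d0.
    by rewrite -(cshift_cdist x j) d0.
  rewrite inE => /andP[r0 ler] ->; rewrite /f cdist_cshift //; split=> //.
  apply: contraTneq r0 => /(congr1 (cdist x)); rewrite cdist_cshift // => ->.
  by rewrite cdistE leqnn subnn.
rewrite card_imset // -sum1dep_card -(big_mkord (fun r => 0 < r <= cdist x y) (fun=> 1)).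
rewrite (big_cat_nat (n := 1)) //=; last by have := ltn_ord x; lia.
rewrite big_nat_cond big_pred0 ?add0n; last by case.
rewrite (big_cat_nat (n := (cdist x y).+1)) //=; last exact: cdist_lt.
rewrite [X in _ + X]big_nat_cond [X in _ + X]big_pred0 ?addn0; last by move=> i; lia.
rewrite big_nat_cond (eq_bigl (fun i => 1 <= i < (cdist x y).+1)); last by move=> i; lia.
by rewrite -big_nat sum_nat_const_nat subn1 muln1.
Qed.

Lemma cint_ocxx x : cint_oc x x = set0.
Proof. by apply/setP=> j; rewrite cint_ocE leqnn inE; lia. Qed.

(** Shifting an interval by one step only changes it at its ends; as an identity
    between multiplicities it also covers the empty interval, where x = y. *)
Lemma cint_oc_shift x y j :
  (ordS j \in cint_oc x y) + (j == y) = (j \in cint_oc x y) + (j == x).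
Proof.
rewrite !cint_ocE val_ordS -!val_eqE /=.
have ltx := ltn_ord x; have lty := ltn_ord y; have ltj := ltn_ord j.
by case: (leqP x y); case: eqP; lia.
Qed.

End CyclicIntervals.

Lemma card_setI_sum (T : finType) (X S : {set T}) :
  #|X :&: S| = \sum_(v in S) (v \in X).
Proof.
rewrite -sum1_card big_mkcond [RHS]big_mkcond; apply: eq_bigr => v _ /=.
by rewrite in_setI andbC; case: (v \in S); case: (v \in X).
Qed.

Lemma card_bigcup_setI (I T : finType) (F : I -> {set T}) (S : {set T}) :
    (forall k k' x, x \in F k -> x \in F k' -> k = k') ->
  #|\bigcup_k F k :&: S| = \sum_k #|F k :&: S|.
Proof.
move=> dF; under [RHS]eq_bigr do rewrite card_setI_sum.
rewrite exchange_big card_setI_sum; apply: eq_bigr => x _ /=.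
case: bigcupP => [[k _ xk]|nx].
  rewrite (bigD1 k) //= xk big1 // => k' nk; case: (boolP (x \in _)) => // xk'.
  by case/eqP: nk; apply: dF xk' xk.
by rewrite big1 // => k _; case: (boolP (x \in _)) => // xk; case: nx; exists k.
Qed.

(** The form in which boundary terms enter the count of essential bullets. *)
Lemma cint_oc_telescope n (g : 'I_n -> nat) (x y : 'I_n) :
  \sum_(v in cint_oc x y) g (ordS v) + g (ordS x)
    = \sum_(v in cint_oc x y) g v + g (ordS y).
Proof.
have bump w : g (ordS w) = \sum_v (v == w) * g (ordS v).
  by rewrite (bigD1 w) //= eqxx mul1n big1 ?addn0 // => v /negPf->.
rewrite [X in X + _]big_mkcond [X in _ = X + _]big_mkcond [RHS]/=.
rewrite [X in _ = X + _](reindex_inj (@ordS_inj n)) /= bump [in RHS]bump -!big_split.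
apply: eq_bigr => v _ /=.
have := cint_oc_shift x y v.
by case: (v \in _); case: (ordS v \in _); case: (v == x); case: (v == y) => /=; lia.
Qed.

(** * Counting along one circuit *)

Section Circuits.
Variables (m n : nat) (l u : 'I_m -> 'I_n) (c : seq (farc m n)).
Implicit Types (i : 'I_m) (j v w x y : 'I_n).

(** Turns sums over the arcs of a circuit into sums over rows, circles and
    crosses. *)
Lemma perm_farc : uniq c ->
  perm_eq c ([seq RowArc i | i <- enum [set i | RowArc i \in c]]
          ++ [seq FwdArc j | j <- enum (circles c)]
          ++ [seq RevArc j | j <- enum (crosses c)]).
Proof.
move=> uc; apply: uniq_perm => // [|e].
  rewrite !cat_uniq !map_inj_uniq ?enum_uniq //=; try by move=> ? ? [].
  rewrite andbT; apply/andP; split; apply/hasPn => e.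
    by rewrite mem_cat => /orP[] /mapP[j _ ->]; apply/mapP => -[].
  by case/mapP=> j _ ->; apply/mapP => -[].
rewrite !mem_cat; case: e => j.
- rewrite (_ : (_ \in map (@FwdArc m n) _) = false); last by apply/mapP => -[].
  rewrite (_ : (_ \in map (@RevArc m n) _) = false); last by apply/mapP => -[].
  by rewrite !orbF mem_map ?mem_enum ?inE // => ? ? [].
- rewrite (_ : (_ \in map (@FwdArc m n) _) = false); last by apply/mapP => -[].
  rewrite (_ : (_ \in map (@RowArc m n) _) = false); last by apply/mapP => -[].
  by rewrite mem_map ?mem_enum ?inE // => ? ? [].
- rewrite (_ : (_ \in map (@RevArc m n) _) = false); last by apply/mapP => -[].
  rewrite (_ : (_ \in map (@RowArc m n) _) = false); last by apply/mapP => -[].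
  by rewrite orbF mem_map ?mem_enum ?inE // => ? ? [].
Qed.

Definition circuit_rows : {set 'I_m} := [set i | RowArc i \in c].

Hypothesis (hc : circuit l u c).

Lemma circuit_uniq : uniq c.
Proof. by case: hc => _ _ /map_uniq. Qed.

Lemma card_circuit_rows : #|circuit_rows| = count (@is_row_arc m n) c.
Proof.
have cnt T (f : T -> farc m n) b (q : seq T) : (forall z, is_row_arc (f z) = b) ->
    count (@is_row_arc m n) (map f q) = b * size q.
  by move=> fb; elim: q => [|z q /= ->]; rewrite ?muln0 // fb mulnS.
rewrite (seq.permP (perm_farc circuit_uniq)) !count_cat.
by rewrite (cnt _ _ true) // !(cnt _ _ false) // mul1n !mul0n !addn0 -cardE.
Qed.

Lemma perm_heads : perm_eq (map (farc_head u) c) (map (farc_tail l) c).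
Proof.
case: hc => ne cy _; case: c ne cy => // e c' _ cy.
suff -> : map (farc_head u) (e :: c') = rot 1 (map (farc_tail l) (e :: c')).
  by rewrite perm_rot.
rewrite rot1_cons -map_rcons; move: cy; rewrite /path.cycle.
elim: c' {1 3}e => [|e' c' IH] f /=; first by rewrite andbT => /eqP->.
by case/andP=> /eqP-> /IH <-.
Qed.

Lemma sum_heads (v : 'I_n) : \sum_(e <- c) (farc_head u e == v) = (v \in circuit_vertices l c).
Proof.
rewrite inE -(perm_mem perm_heads) -count_uniq_mem ?(perm_uniq perm_heads); last by case: hc.
by rewrite count_map -sum1_count [RHS]big_mkcond; apply: eq_bigr => e _ /=; case: eqP.
Qed.

Lemma sum_tails (v : 'I_n) : \sum_(e <- c) (farc_tail l e == v) = (v \in circuit_vertices l c).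
Proof.
rewrite inE -count_uniq_mem; last by case: hc.
by rewrite count_map -sum1_count [RHS]big_mkcond; apply: eq_bigr => e _ /=; case: eqP.
Qed.

Lemma sum_farc (F : farc m n -> nat) :
  \sum_(e <- c) F e = \sum_(i in circuit_rows) F (RowArc i)
    + \sum_(j in circles c) F (FwdArc j) + \sum_(j in crosses c) F (RevArc j).
Proof.
by rewrite (perm_big _ (perm_farc circuit_uniq)) /= !big_cat /= !big_map !big_enum /= addnA.
Qed.

Lemma sum_mem_eq (D : {set 'I_n}) v : \sum_(j in D) (j == v : nat) = (v \in D).
Proof.
rewrite big_mkcond (bigD1 v) //= eqxx big1 ?addn0; first by case: (v \in D).
by move=> j /negPf->; case: ifP.
Qed.

Lemma sum_mem_pred (D : {set 'I_n}) v : \sum_(j in D) (ord_pred j == v : nat) = (ordS v \in D).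
Proof.
rewrite -sum_mem_eq; apply: eq_bigr => j _; congr (nat_of_bool _).
by apply/eqP/eqP => [<-|->]; rewrite ?ordSK ?ord_predK.
Qed.

(** A circuit enters each of its vertices once; the reverse short arc that enters
    v is the one of cross v + 1. *)
Lemma in_degree v : (v \in circuit_vertices l c : nat) =
  \sum_(i in circuit_rows) (u i == v) + (v \in circles c) + (ordS v \in crosses c).
Proof. by rewrite -sum_heads sum_farc /= sum_mem_eq sum_mem_pred. Qed.

Lemma out_degree v : (v \in circuit_vertices l c : nat) =
  \sum_(i in circuit_rows) (ord_pred (l i) == v) + (ordS v \in circles c) + (v \in crosses c).
Proof. by rewrite -sum_tails sum_farc /= sum_mem_eq sum_mem_pred. Qed.

Definition jump_count v : nat := \sum_(i in circuit_rows) (v \in jumped l u i).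

(** Going from v to v + 1, the rows with head v are lost and those with tail v are
    gained, and the two degree equations at v balance them with short arcs. *)
Lemma jump_count_ordS v :
  jump_count (ordS v) + (ordS v \in circles c) + (v \in crosses c)
    = jump_count v + (v \in circles c) + (ordS v \in crosses c).
Proof.
have := etrans (esym (in_degree v)) (out_degree v).
have : jump_count (ordS v) + \sum_(i in circuit_rows) (u i == v)
     = jump_count v + \sum_(i in circuit_rows) (ord_pred (l i) == v).
  rewrite /jump_count -!big_split; apply: eq_bigr => i _ /=.
  by rewrite [u i == v]eq_sym [ord_pred (l i) == v]eq_sym; apply: cint_oc_shift.
lia.
Qed.

(** The net number of times that the circuit passes from before v to v. *)
Definition flow v : int := (Posz (jump_count v + (v \in circles c)) - Posz (v \in crosses c))%R.

Lemma flow_const v w : flow v = flow w.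
Proof.
rewrite -(cshift_cdist v w); elim: (cdist v w) => // r ->.
have := jump_count_ordS (cshift v r); rewrite /flow /cshift iterS; lia.
Qed.

Lemma sum_jump_count (S : {set 'I_n}) :
  \sum_(v in S) jump_count v = \sum_(i in circuit_rows) #|jumped l u i :&: S|.
Proof.
rewrite /jump_count exchange_big /=; apply: eq_bigr => i _ /=.
by rewrite card_setI_sum.
Qed.

Lemma sum_length : (\sum_(e <- c) farc_length l u e = \sum_v flow v)%R.
Proof.
have PoszS (I : Type) (r : seq I) (P : pred I) (F : I -> nat) :
    (\sum_(z <- r | P z) Posz (F z))%R = Posz (\sum_(z <- r | P z) F z).
  by rewrite (big_morph Posz PoszD erefl).
rewrite (perm_big _ (perm_farc circuit_uniq)) /= !big_cat /= !big_map !big_enum /=.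
rewrite sumrB [X in (_ + (_ + X))%R]sumrN !PoszS big_split /=.
have -> : \sum_v jump_count v = \sum_(i in circuit_rows) cdist (ord_pred (l i)) (u i).
  transitivity (\sum_(v in [set: 'I_n]) jump_count v); first by apply: eq_bigl => v; rewrite inE.
  rewrite sum_jump_count; apply: eq_bigr => i _.
  by rewrite setIT card_cint_oc.
rewrite PoszD -addrA; congr (_ + (_ - Posz _))%R.
  by rewrite -!big_mkcond.
by rewrite -!big_mkcond.
Qed.

(** The lengths of the arcs add up to the flow summed over all n vertices, and the
    flow is constant. *)
Lemma flow_winding v : flow v = winding l u c.
Proof.
rewrite /winding sum_length (eq_bigr (fun=> flow v)); last by move=> w _; apply: flow_const.
rewrite sumr_const card_ord -mulr_natr natz mulzK //.
by case: n v => [[]|].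
Qed.

Lemma circle_vertex v : v \in circles c -> v \in circuit_vertices l c.
Proof. by move=> h; have := in_degree v; rewrite h; case: (v \in _); lia. Qed.

Lemma cross_vertex v : v \in crosses c -> v \in circuit_vertices l c.
Proof. by move=> h; have := out_degree v; rewrite h; case: (v \in _); lia. Qed.

Lemma circle_tail_vertex v : v \in circles c -> ord_pred v \in circuit_vertices l c.
Proof.
move=> h; have := out_degree (ord_pred v); rewrite ord_predK h.
by case: (ord_pred v \in _) => //; lia.
Qed.

(** The arcs (v - 1, v) and (v, v - 1) close up a circuit of length 2, which has
    no row arc. *)
Lemma circle_cross v : 1 < n -> 0 < #|circuit_rows| -> v \in circles c ->
  v \notin crosses c.
Proof.
move=> n1 r0; rewrite !inE => cf; apply/negP => cr.
have [k q rc] := rot_to cf.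
have uq : uniq (map (farc_tail l) (rot k c)) by rewrite map_rot rot_uniq; case: hc.
have cy : path.cycle (fun e e' => farc_head u e == farc_tail l e') (rot k c).
  by rewrite rot_cycle; case: hc.
have : RevArc v \in rot k c by rewrite mem_rot.
have : count (@is_row_arc m n) (rot k c) > 0.
  by rewrite (seq.permP (_ : perm_eq _ c)) -?card_circuit_rows ?perm_rot.
rewrite {}rc in uq cy *.
case: q uq cy => [|e q] uq; rewrite /path.cycle //= => /andP[/eqP et pq] rows.
rewrite !inE /= => rv.
have eE : e = RevArc v.
  case/orP: rv => [/eqP->//|/(map_f (farc_tail l))] /=.
  by rewrite et => tq; move: uq; rewrite /= tq andbF.
case: q uq pq {rv} rows => [|e' q] uq; first by rewrite eE.
by move: uq; rewrite eE /= inE => uq /andP[/eqP e't _] _; move: uq; rewrite -e't !inE eqxx !orbT.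
Qed.

(** A vertex of the circuit is a circle, a cross or an essential bullet; compare
    this with how the circuit enters it. *)
Lemma essential_bullet_degree v : 1 < n -> 0 < #|circuit_rows| ->
  (v \in essential_bullets l c) + (v \in crosses c)
    = \sum_(i in circuit_rows) (u i == v) + (ordS v \in crosses c).
Proof.
move=> n1 r0; have := in_degree v.
have := @circle_cross v n1 r0; have := @circle_vertex v; have := @cross_vertex v.
rewrite /essential_bullets /bullets in_setI in_setC in_setU.
case: (v \in circles c) => //=; case: (v \in crosses c) => //=;
  by case: (v \in circuit_vertices l c); lia.
Qed.

Lemma card_essential_bullets : 1 < n -> 0 < #|circuit_rows| ->
  #|essential_bullets l c| = #|circuit_rows|.
Proof.
move=> n1 r0.
have : \sum_v ((v \in essential_bullets l c) + (v \in crosses c))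
     = \sum_v (\sum_(i in circuit_rows) (u i == v) + (ordS v \in crosses c)).
  by apply: eq_bigr => v _; apply: essential_bullet_degree.
rewrite !big_split /=.
rewrite -(reindex_inj (@ordS_inj n) (P := xpredT)
  (F := fun v => nat_of_bool (v \in crosses c))) /=.
move/addIn; rewrite -big_mkcond sum1_card => ->.
rewrite exchange_big /= -sum1_card; apply: eq_bigr => i _ /=.
by rewrite (bigD1 (u i)) //= eqxx big1 // => v; rewrite eq_sym => /negPf->.
Qed.

(** Inside the interval the crosses of [essential_bullet_degree] telescope. *)
Lemma card_essential_bullets_oc x y : 1 < n -> 0 < #|circuit_rows| ->
  #|essential_bullets l c :&: cint_oc x y| + (ordS x \in crosses c)
    = #|[set i in circuit_rows | u i \in cint_oc x y]| + (ordS y \in crosses c).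
Proof.
move=> n1 r0.
have := cint_oc_telescope (fun v => nat_of_bool (v \in crosses c)) x y.
have : \sum_(v in cint_oc x y) ((v \in essential_bullets l c) + (v \in crosses c))
     = \sum_(v in cint_oc x y) (\sum_(i in circuit_rows) (u i == v) + (ordS v \in crosses c)).
  by apply: eq_bigr => v _; apply: essential_bullet_degree.
rewrite !big_split /= -card_setI_sum.
have -> : \sum_(v in cint_oc x y) \sum_(i in circuit_rows) (u i == v)
        = #|[set i in circuit_rows | u i \in cint_oc x y]|.
  rewrite exchange_big /= -sum1_card big_mkcond [RHS]big_mkcond; apply: eq_bigr => i _ /=.
  rewrite [X in _ = if X then _ else _]in_set; case: (i \in circuit_rows) => //=.
  transitivity (nat_of_bool (u i \in cint_oc x y)); last by case: (u i \in _).
  rewrite -sum_mem_eq.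
  by apply: eq_bigr => v _; rewrite eq_sym.
move: #|_ :&: _| #|[set i in _ | _]| (\sum_(v in _) _) (\sum_(v in _) _).
by move=> b h t1 t2; lia.
Qed.

Lemma head_off_circuit_not_cross r :
  u r \notin circuit_vertices l c -> ordS (u r) \notin crosses c.
Proof.
apply: contraNN => cr; have := in_degree (u r); rewrite cr addn1.
by case: (u r \in _).
Qed.

Lemma row_head_not_cross r : r \in circuit_rows ->
  ordS (u r) \notin crosses c.
Proof.
move=> rc; apply/negP => cr; have := in_degree (u r); rewrite cr (bigD1 r) //= eqxx.
by case: (u r \in _); lia.
Qed.

Lemma row_tail_not_circle r : r \in circuit_rows -> l r \notin circles c.
Proof.
move=> rc; apply/negP => cr; have := out_degree (ord_pred (l r)).
by rewrite ord_predK cr (bigD1 r) //= eqxx; case: (_ \in _); lia.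
Qed.

Lemma row_head_vertex r : r \in circuit_rows ->
  u r \in circuit_vertices l c.
Proof.
move=> rc; have := in_degree (u r); rewrite (bigD1 r) //= eqxx.
by case: (u r \in _).
Qed.

Lemma row_tail_vertex r : r \in circuit_rows ->
  ord_pred (l r) \in circuit_vertices l c.
Proof.
move=> rc; have := out_degree (ord_pred (l r)); rewrite (bigD1 r) //= eqxx.
by case: (_ \in _).
Qed.

End Circuits.

(** * Blocks: positions relative to a set of columns *)

Section Rank.
Variables (n : nat) (B : {set 'I_n}).
Implicit Types x y v w b : 'I_n.

Definition rank v : nat := #|[set b in B | b <= v]|.

(** The elements b_0, ..., b_(s-1) of B cut the circle into s blocks, each made of
    one of them and of the vertices up to the next; [block] numbers them cyclically.
    The block of b_i is i + 1 modulo s. *)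
Definition block v : nat := rank v %% #|B|.

Lemma card_oc_rank x y :
  #|B :&: cint_oc x y| + rank x = rank y + (if x <= y then 0 else #|B|).
Proof.
have cnt (P : pred 'I_n) : #|[set b in B | P b]| = \sum_(b in B) P b.
  by rewrite -sum1dep_card big_mkcondr.
have -> : B :&: cint_oc x y = [set b in B | b \in cint_oc x y].
  by apply/setP=> b; rewrite !inE.
have -> : (if x <= y then 0 else #|B|) = \sum_(b in B) (if x <= y then 0 else 1).
  by rewrite sum_nat_const; case: ifP; rewrite ?muln0 ?muln1.
rewrite /rank !cnt -!big_split; apply: eq_bigr => b _ /=; rewrite cint_ocE.
by case: (leqP x y); case: (leqP b x); case: (leqP b y); lia.
Qed.

(** The vertices of the circle project to Z / s so that the elements of B in
    (x, y] count the step from x to y. *)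
Lemma block_oc x y : #|B :&: cint_oc x y| + block x = block y %[mod #|B|].
Proof.
rewrite /block modnDmr card_oc_rank modn_mod.
by case: ifP => _; rewrite ?addn0 ?modnDr.
Qed.

Lemma card_oc_le x y : #|B :&: cint_oc x y| <= #|B|.
Proof. exact/subset_leq_card/subsetIl. Qed.

(** The two cases: y comes after x inside their block, or (x, y] goes round the
    circle. *)
Lemma eq_block x y : block x = block y ->
  #|B :&: cint_oc x y| = 0 \/ #|B :&: cint_oc x y| = #|B|.
Proof.
move=> e; have := block_oc x y; have := card_oc_le x y.
rewrite e -[X in _ = X %[mod _]]add0n => le /eqP; rewrite eqn_modDr mod0n.
move: le; rewrite leq_eqVlt => /orP[/eqP->|lt]; first by right.
by rewrite modn_small // => /eqP; left.
Qed.

Lemma rank_gt0 b : b \in B -> 0 < rank b.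
Proof. by move=> bB; apply/card_gt0P; exists b; rewrite inE bB /=. Qed.

(** An interval that misses some element of B meets B in consecutive elements,
    which its size and the block of its start determine.  The right-hand side is
    the entry of a circulant matrix. *)
Lemma window_mem x y b : b \in B -> #|B :&: cint_oc x y| < #|B| ->
  (b \in cint_oc x y) = (((rank b).-1 + #|B| - block x) %% #|B| < #|B :&: cint_oc x y|).
Proof.
move=> bB lt; have s0 : 0 < #|B| by lia.
have blt : block x < #|B| by rewrite ltn_mod.
have rb := rank_gt0 bB.
have := block_oc x b; have := card_oc_le x b; rewrite [block b]/block modn_mod.
(* Both intervals start at x, so the one with more elements of B is the longer. *)
have mem_cut : (b \in cint_oc x y) = (0 < #|B :&: cint_oc x b| <= #|B :&: cint_oc x y|).
  case: (altP (b =P x)) => [->|nbx].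
    by rewrite cint_ocxx setI0 cards0 cint_ocE; case: (leqP x y) => //; lia.
  have bxb : b \in cint_oc x b.
    by move: nbx; rewrite -val_eqE cint_ocE /=; case: (leqP x b); lia.
  have -> /= : 0 < #|B :&: cint_oc x b|.
    by apply/card_gt0P; exists b; rewrite inE bB.
  case: (boolP (b \in cint_oc x y)) => bxy; symmetry.
    apply: subset_leq_card; apply: setIS; apply/subsetP=> j.
    by move: bxy; rewrite !cint_ocE; case: (leqP x y); case: (leqP x b); lia.
  apply/negbTE; rewrite -ltnNge; apply: proper_card; apply/properP; split; last first.
    by exists b; rewrite inE bB // negb_and bxy orbT.
  apply: setIS; apply/subsetP=> j; move: bxy nbx; rewrite !cint_ocE -val_eqE /=.
  by case: (leqP x y); case: (leqP x b); lia.
rewrite mem_cut; move: (#|B :&: cint_oc x b|) => c cle ec.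
have ec' : c + #|B| = (rank b).-1 + #|B| - block x + 1 %[mod #|B|].
  rewrite modnDr; apply/eqP; rewrite -(eqn_modDr (block x)) ec; apply/eqP.
  by rewrite (_ : _ + 1 + _ = rank b + #|B|) ?modnDr //; lia.
(* No element of B is counted when b = x; cyclically b is then the last one. *)
case: c cle ec ec' => [|c] cle _ ec'.
  rewrite ltn0 /=; symmetry; apply/negbTE; rewrite -leqNgt.
  suff -> : ((rank b).-1 + #|B| - block x) %% #|B| = #|B|.-1 by rewrite -ltnS prednK.
  have /eqP : (rank b).-1 + #|B| - block x + 1 = #|B|.-1 + 1 %[mod #|B|].
    by rewrite -ec' add0n addn1 prednK.
  by rewrite eqn_modDr => /eqP->; rewrite modn_small //; lia.
suff -> : ((rank b).-1 + #|B| - block x) %% #|B| = c by [].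
have /eqP : (rank b).-1 + #|B| - block x + 1 = c + 1 %[mod #|B|].
  by rewrite -ec' modnDr addn1.
by rewrite eqn_modDr => /eqP->; rewrite modn_small.
Qed.

Lemma rank_enum_val (i : 'I_#|B|) : rank (enum_val i) = i.+1.
Proof.
have sB : sorted (relpre val ltn) (enum B).
  rewrite /enum_mem -enumT; apply: sorted_filter; first by move=> ? ? ?; apply: ltn_trans.
  by rewrite -sorted_map val_enum_ord iota_ltn_sorted.
have mono (k k' : 'I_#|B|) : (enum_val k <= enum_val k') = (k <= k').
  have lt_mono (q q' : 'I_#|B|) : q < q' -> enum_val q < enum_val q'.
    have x0 : 'I_n := enum_val q.
    move=> lt; rewrite !(enum_val_nth x0).
    apply: (sorted_ltn_nth (leT := relpre val ltn)) => //; rewrite ?inE -?cardE //.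
    by move=> ? ? ?; apply: ltn_trans.
  case: (ltngtP k k') => [/lt_mono/ltnW->//|/lt_mono|/val_inj->]; last exact: leqnn.
  by rewrite ltnNge => /negbTE.
rewrite /rank -[RHS](card_ord i.+1).
have le : i.+1 <= #|B| by [].
have <- : [set enum_val (widen_ord le k) | k : 'I_i.+1] = [set b in B | b <= enum_val i].
  apply/setP=> b; apply/imsetP/idP => [[k _ ->]|].
    by rewrite inE enum_valP mono /= -ltnS.
  rewrite inE => /andP[bB]; rewrite -(enum_rankK_in bB bB) mono -ltnS => lt.
  by exists (Ordinal lt) => //; congr enum_val; apply: val_inj.
rewrite card_imset ?cardsT // => k k' /enum_val_inj /(congr1 val) /= /val_inj.
exact.
Qed.

Lemma block_enum_val t : t < #|B| -> exists2 b, b \in B & block b = t.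
Proof.
case: t => [|t] lt.
  have lt' : #|B|.-1 < #|B| by lia.
  exists (enum_val (Ordinal lt')); rewrite ?enum_valP // /block rank_enum_val /=.
  by rewrite prednK // modnn.
have lt' : t < #|B| by lia.
exists (enum_val (Ordinal lt')); rewrite ?enum_valP // /block rank_enum_val /=.
by rewrite modn_small.
Qed.

End Rank.

(** * Rows without domination *)

Section Rows.
Variables (m n : nat) (A : 'M[bool]_(m, n)) (l u : 'I_m -> 'I_n).
Hypotheses (hA : circular A l u) (m2 : 1 < m).
Implicit Types i r : 'I_m.

(** Otherwise row i is full and dominates another row. *)
Lemma tail_neq_head i : ord_pred (l i) != u i.
Proof.
case: hA => rowA dom _ _; apply/eqP => e.
have [r nri] : exists r, r != i.
  have := m2; case: (altP (i =P Ordinal (ltnW m2))) => [->|ni] h; last first.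
    by exists (Ordinal (ltnW m2)); rewrite eq_sym.
  by exists (Ordinal m2).
have := dom i r; rewrite /dominates eq_sym nri /= => /negP; apply.
apply/subsetP=> j _; case: (rowA i) => _ ->; rewrite cint_ccE -e val_ord_pred.
have ltj := ltn_ord j; have ltl := ltn_ord (l i).
by case: eqP => l0; case: (leqP (l i)); lia.
Qed.

Lemma row_supp_jumped i : row_supp A i = jumped l u i.
Proof.
have := tail_neq_head i.
case: hA => rowA _ _ _; case: (rowA i) => _ -> ne; apply/setP=> j.
have {ne} : ord_pred (l i) != u i :> nat by [].
have ltl := ltn_ord (l i); have ltu := ltn_ord (u i); have ltj := ltn_ord j.
rewrite /jumped /farc_head /farc_tail cint_ccE cint_ocE val_ord_pred.
case: (eqVneq (nat_of_ord (l i)) 0) => l0 ne; case: (leqP (l i) (u i)) => lu.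
all: by [case: (leqP n.-1 (u i)); lia | case: (leqP (l i).-1 (u i)); lia].
Qed.

(** If only one of the two memberships held, one of the two intervals would
    contain the other. *)
Lemma head_jumped r i : (u i \in jumped l u r) = (l r \in jumped l u i).
Proof.
rewrite -!row_supp_jumped; case: hA => rowA dom _ _.
have [_ er] := rowA r; have [_ ei] := rowA i.
have ltl := ltn_ord (l r); have ltu := ltn_ord (u r).
have ltl' := ltn_ord (l i); have ltu' := ltn_ord (u i).
case: (altP (r =P i)) => [->|nri].
  by rewrite ei !cint_ccE; case: (leqP (l i) (u i)); lia.
have nir : i != r by rewrite eq_sym.
have := dom r i; have := dom i r; rewrite /dominates nri nir /= => d1 d2.
apply/idP/idP => h; [apply: contraR d2|apply: contraR d1] => h'; apply/subsetP=> j; move: h h';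
rewrite er ei !cint_ccE;
by case: (leqP (l i) (u i)); case: (leqP (l r) (u r)); lia.
Qed.

End Rows.

(** * Circulant minors in terms of traces *)

Lemma modn_subE s a b : a < s -> b < s ->
  (a + s - b) %% s = if b <= a then a - b else a + s - b.
Proof.
move=> lta ltb; case: leqP => le; last by rewrite modn_small //; lia.
by rewrite (_ : a + s - b = a - b + s) ?modnDr ?modn_small //; lia.
Qed.

Lemma circulantE s p (i j : 'I_s) : p < s -> circulant s p i j = (cdist i j < p).
Proof. by move=> ps; rewrite mxE mem_cint_co_cshift. Qed.

Lemma card_circulant_row s p (i : 'I_s) : p < s -> #|[set j | circulant s p i j]| = p.
Proof.
move=> ps.
have -> : [set j | circulant s p i j] = [set cshift i (widen_ord (ltnW ps) r) | r : 'I_p].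
  apply/setP=> j; rewrite inE circulantE //; apply/idP/imsetP => [lt|[r _ ->]].
    by exists (Ordinal lt); rewrite //= cshift_cdist.
  by rewrite cdist_cshift //= (ltn_trans _ ps).
rewrite card_imset ?card_ord // => r r' /(congr1 (cdist i)) /=.
by rewrite !cdist_cshift ?(ltn_trans _ ps) // => /val_inj.
Qed.

Lemma mx_iso_circulant m' n' (M : 'M[bool]_(m', n')) s p : p < s ->
  mx_iso M (circulant s p) ->
  [/\ m' = s, n' = s & forall i, #|[set j | M i j]| = p].
Proof.
move=> ps [[em en] [f [g E]]]; move: ps en f g E; case: s / em => ps en.
move: M ps; case: m' / en => M ps f g E.
split=> // i; rewrite -(card_circulant_row (f^-1%g i) ps) -E castmx_id.
have -> : [set j | row_perm f (col_perm g M) (f^-1%g i) j] = g @^-1: [set j | M i j].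
  by apply/setP=> j; rewrite !inE !mxE permKV.
by rewrite card_preimset //; apply: perm_inj.
Qed.

Lemma mx_iso_circulantI m' n' (M : 'M[bool]_(m', n')) s p (f : 'I_s -> 'I_m') :
  p < s -> m' = s -> injective f -> forall en : n' = s,
  (forall i j, M (f i) j = (cdist i (cast_ord en j) < p)) -> mx_iso M (circulant s p).
Proof.
move=> ps em; move: ps f; case: s / em => ps f fI en.
move: M ps f fI; case: m' / en => M ps f fI ME.
exists (erefl, erefl), (perm fI), 1%g; apply/matrixP => i j.
by rewrite castmx_id circulantE // !mxE permE perm1 ME cast_ord_id.
Qed.

Section Criterion.
Variables (m n : nat) (A : 'M[bool]_(m, n)) (l u : 'I_m -> 'I_n) (s p : nat).
Hypotheses (hA : circular A l u) (p2 : 1 < p) (ps : p < s).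
Implicit Types (i r : 'I_m) (B N : {set 'I_n}).

Definition departure r : 'I_n := ord_pred (l r).

Definition trace B r : {set 'I_n} := B :&: jumped l u r.

(** The conditions for B to be the set of columns of a minor isomorphic to C_s^p.
    The third one asks for each interval of p consecutive elements of B through the
    block in which it starts. *)
Definition circulant_trace B : Prop :=
  [/\ #|B| = s, forall r, p <= #|trace B r|
    & forall t, t < s -> exists2 r, #|trace B r| = p & block B (departure r) = t].

Lemma trace_mem B r b : #|B| = s -> b \in B -> #|trace B r| < s ->
  (b \in trace B r) = (((rank B b).-1 + s - block B (departure r)) %% s < #|trace B r|).
Proof.
by move=> <- bB lt; rewrite [LHS]inE bB; apply: window_mem.
Qed.

(** By [window_mem], a smaller size is the only way for a trace to be smaller when
    the start is the same. *)
Lemma trace_start_sub B r r' : #|B| = s ->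
  block B (departure r) = block B (departure r') ->
  #|trace B r| <= #|trace B r'| -> #|trace B r| < s -> trace B r \subset trace B r'.
Proof.
move=> sB e le lt; case: (leqP s #|trace B r'|) => [|lt'].
  move=> h; suff -> : trace B r' = B by apply: subsetIl.
  by apply/eqP; rewrite eqEcard subsetIl sB.
apply/subsetP=> b br; have bB : b \in B by case/setIP: br.
by move: br; rewrite !trace_mem // -e => /leq_trans; apply.
Qed.

(** Compare the first element of the second interval with the element just before
    it: an interval of fewer than s elements has only one start. *)
Lemma trace_eq_start B r r' : #|B| = s -> #|trace B r| = p ->
  trace B r = trace B r' -> block B (departure r) = block B (departure r').
Proof.
move=> sB tp tE; have tp' : #|trace B r'| = p by rewrite -tE.
set x := block B _; set y := block B _.
have s0 : 0 < s by lia.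
have xs : x < s by rewrite /x /block sB ltn_mod.
have ys : y < s by rewrite /y /block sB ltn_mod.
have win k : k < s -> ((k + s - x) %% s < p) = ((k + s - y) %% s < p).
  rewrite -{1}sB => ks; have /setP/(_ (enum_val (Ordinal ks))) := tE.
  by rewrite !trace_mem ?enum_valP ?tp ?tp' // rank_enum_val.
have := win y ys; rewrite !modn_subE // leqnn subnn.
(* The residue that precedes y. *)
pose z := if y == 0 then s.-1 else y.-1.
have zs : z < s by rewrite /z; case: eqP; lia.
have := win z zs; rewrite !modn_subE //.
rewrite /z; case: (eqVneq y 0) => y0; case: (leqP x y) => xy;
  by [case: (leqP x s.-1); case: (leqP y s.-1); lia | case: (leqP x y.-1); case: (leqP y y.-1); lia].
Qed.

Lemma trace_supp B r : 1 < m -> trace B r = row_supp A r :\: ~: B.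
Proof. by move=> m2; rewrite /trace -(row_supp_jumped hA) // setDE setCK setIC. Qed.

Lemma minor_rowsP N r : 1 < m ->
  reflect (forall r', trace (~: N) r' \subset trace (~: N) r ->
             trace (~: N) r' = trace (~: N) r /\ r <= r')
    (r \in minor_rows A N).
Proof.
move=> m2; rewrite inE; apply: (iffP forallP) => h r'.
  have /implyP := h r'; rewrite !trace_supp // setCK => h' /h' /andP[/eqP-> ->].
  by [].
by apply/implyP; have := h r'; rewrite !trace_supp // setCK => h' /h'[-> ->]; rewrite eqxx.
Qed.

(** The rows of the minor have the minimal traces, which are the traces with p
    elements, one row for each start; sorting them by start gives C_s^p. *)
Lemma circulant_trace_iso N : 1 < m -> circulant_trace (~: N) ->
  mx_iso (minor A N) (circulant s p).
Proof.
move=> m2 [sB geB exB]; set B := ~: N in sB geB exB *.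
have s0 : 0 < s by lia.
have minor_card r : r \in minor_rows A N -> #|trace B r| = p.
  move=> /(minor_rowsP _ _ m2) mr; have bs : block B (departure r) < s by rewrite /block sB ltn_mod.
  have [r' tp e] := exB _ bs.
  by have [//|<- //] := mr r' _; apply: trace_start_sub; rewrite ?tp.
have ex t : t < s -> exists2 r, r \in minor_rows A N & block B (departure r) = t.
  move=> /exB[r1 tp e1].
  have Q1 : trace B r1 == trace B r1 by [].
  case: (arg_minnP (P := fun r => trace B r == trace B r1)
    (fun r : 'I_m => r : nat) Q1) => r /eqP tr minr.
  exists r; last by rewrite -e1; apply: trace_eq_start; rewrite ?tr.
  apply/(minor_rowsP _ _ m2) => r' sub.
  have tE : trace B r' = trace B r.
    by apply/eqP; rewrite eqEcard sub tr tp geB.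
  by split=> //; apply: minr; rewrite tE tr.
have blt r : block B (departure r) < s by rewrite /block sB ltn_mod.
pose start (k : 'I_#|minor_rows A N|) : 'I_s := Ordinal (blt (enum_val k)).
have startI : injective start.
  move=> k k' /(congr1 val) /= e; apply: enum_val_inj.
  have mk := enum_valP k; have mk' := enum_valP k'.
  have tk := minor_card _ mk; have tk' := minor_card _ mk'.
  have /(minor_rowsP _ _ m2) h := mk; have /(minor_rowsP _ _ m2) h' := mk'.
  have [|_ le] := h (enum_val k'); first by apply: trace_start_sub; rewrite ?tk ?tk'.
  have [|_ le'] := h' (enum_val k); first by apply: trace_start_sub; rewrite ?tk ?tk'.
  by apply/val_inj/eqP; rewrite eqn_leq le le'.
have onto (t : 'I_s) : exists k, start k == t.
  have [r mr e] := ex _ (ltn_ord t).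
  by exists (enum_rank_in mr r); rewrite -val_eqE /= enum_rankK_in // e.
pose f t := xchoose (onto t).
have fK t : start (f t) = t by apply/eqP/(xchooseP (onto t)).
have fI : injective f by move=> t t' /(congr1 start); rewrite !fK.
have em : #|minor_rows A N| = s.
  have := leq_card _ startI; have := leq_card _ fI; rewrite !card_ord => h h'.
  by apply/eqP; rewrite eqn_leq h h'.
(* The k-th element of B has block k + 1, so columns need no permutation. *)
apply: (mx_iso_circulantI ps em fI (en := sB)) => t j; rewrite mxE.
set r := enum_val (f t).
have rm : r \in minor_rows A N by apply: enum_valP.
have tr := minor_card _ rm.
have -> : A r (enum_val j) = (enum_val j \in trace B r).
  by rewrite trace_supp // setCK inE inE (negPf (_ : enum_val j \notin N)) // -in_setC enum_valP.
rewrite trace_mem ?enum_valP ?tr //.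
rewrite rank_enum_val /= /cdist /=.
by have -> : block B (departure r) = t := congr1 val (fK t).
Qed.

(** Every trace contains a minimal one.  The s rows of the minor have different
    traces of size p, so their starts exhaust Z / s, whichever permutation of the
    columns the isomorphism uses. *)
Lemma iso_circulant_trace N : mx_iso (minor A N) (circulant s p) ->
  1 < m /\ circulant_trace (~: N).
Proof.
move=> /(mx_iso_circulant ps)[em en rowp].
have m2 : 1 < m by apply: (@leq_trans s); [lia | rewrite -em -[m in _ <= m]card_ord max_card].
split=> //; set B := ~: N in em en rowp *.
have minor_card r : r \in minor_rows A N -> #|trace B r| = p.
  move=> mr; rewrite -(rowp (enum_rank_in mr r)).
  rewrite -(card_imset _ enum_val_inj); apply: eq_card => b.
  apply/idP/imsetP => [|[j jM ->]].
    rewrite trace_supp // setCK !inE => /andP[bN Arb].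
    have bB : b \in B by rewrite inE.
    exists (enum_rank_in bB b); last by rewrite enum_rankK_in.
    by rewrite inE mxE !enum_rankK_in.
  move: jM; rewrite inE mxE enum_rankK_in // => h.
  by rewrite trace_supp // setCK inE inE h andbT -in_setC enum_valP.
have below r : exists2 r0, r0 \in minor_rows A N & trace B r0 \subset trace B r.
  (* Minimal trace first, then minimal index: r' < m makes the weight lexicographic. *)
  case: (arg_minnP (P := fun r' => trace B r' \subset trace B r)
    (fun r' : 'I_m => #|trace B r'| * m + r') (subxx _)) => r0 sub0 min0.
  exists r0 => //; apply/(minor_rowsP _ _ m2) => r' sub.
  have := min0 r' (subset_trans sub sub0); have := subset_leq_card sub.
  have := ltn_ord r'; have := ltn_ord r0 => lt0 lt' le le'.
  have tE : trace B r' = trace B r0.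
    by apply/eqP; rewrite eqEcard sub; nia.
  by split=> //; rewrite tE leq_add2l in le'.
have blt r : block B (departure r) < s.
  by rewrite /block en ltn_mod; lia.
split=> // [r|t ts].
  by have [r0 m0 sub] := below r; rewrite -(minor_card _ m0) subset_leq_card.
pose start r : 'I_s := Ordinal (blt r).
have startI : {in minor_rows A N &, injective start}.
  move=> r r' mr mr' /(congr1 val) /= e.
  have tk := minor_card _ mr; have tk' := minor_card _ mr'.
  have /(minor_rowsP _ _ m2) h := mr; have /(minor_rowsP _ _ m2) h' := mr'.
  have [|_ le] := h r'; first by apply: trace_start_sub; rewrite ?tk ?tk'.
  have [|_ le'] := h' r; first by apply: trace_start_sub; rewrite ?tk ?tk'.
  by apply/val_inj/eqP; rewrite eqn_leq le le'.
have /eqP full : start @: minor_rows A N == setT.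
  by rewrite eqEcard subsetT card_in_imset // em cardsT card_ord leqnn.
have : Ordinal ts \in start @: minor_rows A N by rewrite full inE.
case/imsetP=> r mr /(congr1 val) /= ->.
by exists r => //; apply: minor_card.
Qed.

End Criterion.

(** * Bullets jumped by a row *)

Section Jumps.
Variables (m n : nat) (A : 'M[bool]_(m, n)) (l u : 'I_m -> 'I_n).
Hypotheses (hA : circular A l u) (m2 : 1 < m).
Implicit Types i r : 'I_m.

Lemma n_gt1 : 1 < n.
Proof.
pose i := Ordinal m2; have : ord_pred (l i) != u i :> nat := tail_neq_head hA m2 i.
have := ltn_ord (ord_pred (l i)); have := ltn_ord (u i).
by move: (nat_of_ord (u i)) (nat_of_ord (ord_pred _)) => x y; lia.
Qed.

(** By [head_jumped] the heads of the circuit inside row r are as many as its row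
    arcs over l r, and the flow at l r relates these to the winding number. *)
Lemma jumped_essential_bullets c r : circuit l u c -> 0 < #|circuit_rows c| ->
  Posz (#|essential_bullets l c :&: jumped l u r| + (l r \in circles c))
    = (winding l u c + Posz (ordS (u r) \in crosses c))%R.
Proof.
move=> hc c0; rewrite -(flow_winding hc (l r)) /flow.
have := card_essential_bullets_oc hc (ord_pred (l r)) (u r) n_gt1 c0.
rewrite ord_predK.
have -> : #|[set i in circuit_rows c | u i \in cint_oc (ord_pred (l r)) (u r)]|
        = jump_count l u c (l r).
  rewrite -sum1dep_card big_mkcondr; apply: eq_bigr => i _ /=.
  by rewrite -(head_jumped hA m2) /jumped /=; case: (u i \in _).
rewrite -/(jumped l u r); move: #|_| (jump_count _ _ _ _) => a b; lia.
Qed.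

Lemma head_inj : injective u.
Proof.
clear m2; move=> i r e; have [_ dom _ _] := hA; have [rowA _ _ _] := hA.
apply/eqP; apply: contraT => nir.
have := dom i r; have := dom r i; rewrite /dominates nir eq_sym nir /=.
have [_ ->] := rowA r; have [_ ->] := rowA i; rewrite e => d1 d2.
have ltu := ltn_ord (u r); have ltl := ltn_ord (l r); have ltl' := ltn_ord (l i).
case: (leqP (cdist (l i) (u r)) (cdist (l r) (u r))); rewrite !cdistE => h.
  case/negP: d1; apply/subsetP => j; rewrite !cint_ccE; have := ltn_ord j; move: h.
  by case: (leqP (l i) (u r)); case: (leqP (l r) (u r)); lia.
case/negP: d2; apply/subsetP => j; rewrite !cint_ccE; have := ltn_ord j; move: h.
by case: (leqP (l i) (u r)); case: (leqP (l r) (u r)); lia.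
Qed.

End Jumps.

(** * From a family of circuits to a minor *)

Section Family.
Variables (m n : nat) (A : 'M[bool]_(m, n)) (l u : 'I_m -> 'I_n) (s p : nat).
Hypotheses (hA : circular A l u) (p2 : 1 < p) (ps : p < s).
Variable (G : 'I_(gcdn s p) -> seq (farc m n)).
Hypothesis (hG : good_family l u G).
Implicit Types (i r : 'I_m).

Let a := gcdn s p.
Let B := family_essential_bullets l G.

Lemma gcdn_pos : 0 < a. Proof. by rewrite gcdn_gt0; lia. Qed.

Lemma sdiv_gt1 : 1 < s %/ a.
Proof.
have a0 := gcdn_pos; rewrite leq_divRL // mul2n -addnn.
have /dvdnP[k e] : a %| s by apply: dvdn_gcdl.
have : a <= p by apply: dvdn_leq; [lia | apply: dvdn_gcdr].
by rewrite e; case: k e => [|[|k]] e le; nia.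
Qed.

Lemma family_circuit k : circuit l u (G k). Proof. by case: hG => -[]. Qed.

Lemma family_rows k : #|circuit_rows (G k)| = s %/ a.
Proof. by rewrite (card_circuit_rows (family_circuit k)); case: hG => _ _ /(_ k)[]. Qed.

Lemma family_rows_gt0 k : 0 < #|circuit_rows (G k)|.
Proof. by rewrite family_rows; have := sdiv_gt1; lia. Qed.

Lemma family_m_gt1 : 1 < m.
Proof.
have k : 'I_a := Ordinal gcdn_pos.
have := sdiv_gt1; rewrite -(family_rows k) => /leq_trans; apply.
by rewrite -[m in _ <= m]card_ord max_card.
Qed.

Lemma family_vertex_inj k k' v : v \in circuit_vertices l (G k) ->
  v \in circuit_vertices l (G k') -> k = k'.
Proof.
case: hG => -[_ dis] _ _ vk vk'; apply/eqP; apply: contraT => /dis.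
by rewrite disjoint_subset => /subsetP/(_ _ vk); rewrite inE vk'.
Qed.

Lemma family_setI (S : {set 'I_n}) :
  #|B :&: S| = \sum_k #|essential_bullets l (G k) :&: S|.
Proof.
apply: card_bigcup_setI => k k' v /setIP[_ vk] /setIP[_ vk'].
exact (family_vertex_inj vk vk').
Qed.

Lemma family_row_inj k k' r :
  r \in circuit_rows (G k) -> r \in circuit_rows (G k') -> k = k'.
Proof.
move=> rk rk'; apply: (@family_vertex_inj _ _ (u r)).
  exact (row_head_vertex (family_circuit k) rk).
exact (row_head_vertex (family_circuit k') rk').
Qed.

Lemma family_head_not_cross k k' r :
  r \in circuit_rows (G k) -> ordS (u r) \notin crosses (G k').
Proof.
move=> rk; case: (altP (k' =P k)) => [->|nk].
  exact (row_head_not_cross (family_circuit k) rk).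
apply: head_off_circuit_not_cross; first exact: family_circuit.
apply: contraNN nk => v'; apply/eqP.
exact (family_vertex_inj v' (row_head_vertex (family_circuit k) rk)).
Qed.

Lemma family_tail_not_circle k k' r :
  r \in circuit_rows (G k) -> l r \notin circles (G k').
Proof.
move=> rk; case: (altP (k' =P k)) => [->|nk].
  exact (row_tail_not_circle (family_circuit k) rk).
apply: contraNN nk => c'; apply/eqP.
apply: (@family_vertex_inj _ _ (ord_pred (l r))).
  exact (circle_tail_vertex (family_circuit k') c').
exact (row_tail_vertex (family_circuit k) rk).
Qed.

Lemma family_card : #|B| = s.
Proof.
rewrite -[B]setIT family_setI (eq_bigr (fun=> s %/ a)).
  by rewrite sum_nat_const card_ord mulnC divnK // dvdn_gcdl.
move=> k _; rewrite setIT (card_essential_bullets (family_circuit k)) ?family_rows_gt0 ?family_rows //.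
exact: n_gt1 hA family_m_gt1.
Qed.

Lemma family_jumped k r :
  #|essential_bullets l (G k) :&: jumped l u r| + (l r \in circles (G k))
    = p %/ a + (ordS (u r) \in crosses (G k)).
Proof.
have := jumped_essential_bullets hA family_m_gt1 r (family_circuit k) (family_rows_gt0 k).
by case: hG => _ _ /(_ k)[_ ->]; rewrite -/a; move: #|_ :&: _| (p %/ a) => b q; lia.
Qed.

(** By [family_jumped], the only possible value below p / a is that of a bad
    arc. *)
Lemma family_jumped_ge k r :
  p %/ a <= #|essential_bullets l (G k) :&: jumped l u r|.
Proof.
have := family_jumped k r.
case: hG => _ /(_ r) good /(_ k)[_ wk]; rewrite leqNgt => E; apply/negP => lt.
case: good; exists k; rewrite /bad_arc wk setIC.
rewrite -/a; move: #|_ :&: _| (p %/ a) E lt => b q; lia.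
Qed.

Lemma sum_pdiv : \sum_(k : 'I_a) (p %/ a) = p.
Proof. by rewrite sum_nat_const card_ord mulnC divnK // dvdn_gcdr. Qed.

Lemma family_trace_ge r : p <= #|trace l u B r|.
Proof. by rewrite family_setI -{1}sum_pdiv; apply: leq_sum => k _; apply: family_jumped_ge. Qed.

(** A row of the family enters u r and leaves l r - 1, so disjointness keeps the
    short arcs of all the circuits from these two vertices. *)
Lemma family_row_trace k r : r \in circuit_rows (G k) -> #|trace l u B r| = p.
Proof.
move=> rk; rewrite family_setI -[RHS]sum_pdiv; apply: eq_bigr => k' _.
have := family_jumped k' r.
rewrite (negPf (family_head_not_cross k' rk)) (negPf (family_tail_not_circle k' rk)).
by rewrite !addn0.
Qed.

Let F := \bigcup_k circuit_rows (G k).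

Lemma card_family_rows : #|F| = s.
Proof.
rewrite -[F]setIT card_bigcup_setI; last by move=> k k' r; apply: family_row_inj.
under eq_bigr => k _ do rewrite setIT family_rows.
by rewrite sum_nat_const card_ord mulnC divnK // dvdn_gcdl.
Qed.

(** No boundary term remains, as heads of row arcs are not entered by short
    arcs. *)
Lemma card_bullets_between_heads r r' : r \in F -> r' \in F ->
  #|B :&: cint_oc (u r) (u r')| = #|F :&: u @^-1: cint_oc (u r) (u r')|.
Proof.
move=> /bigcupP[k1 _ rk1] /bigcupP[k2 _ rk2]; rewrite family_setI.
rewrite card_bigcup_setI; last by move=> k k' i; apply: family_row_inj.
apply: eq_bigr => k _.
have := card_essential_bullets_oc (family_circuit k) (u r) (u r')
  (n_gt1 hA family_m_gt1) (family_rows_gt0 k).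
rewrite (negPf (family_head_not_cross k rk1)) (negPf (family_head_not_cross k rk2)).
by rewrite !addn0 => ->; apply: eq_card => i; rewrite !inE.
Qed.

(** Two rows of the family that start in one block end in one block.  The bullets
    between their heads would then be none or all s, but they are as many as the
    heads in between, the second included and the first not. *)
Lemma family_circulant_trace : circulant_trace l u s p B.
Proof.
split; [exact: family_card | exact: family_trace_ge | move=> t ts].
have FE r : r \in F -> #|trace l u B r| = p.
  by case/bigcupP=> k _; apply: family_row_trace.
have blt r : block B (departure l r) < s by rewrite /block family_card ltn_mod; lia.
pose start r : 'I_s := Ordinal (blt r).
have startI : {in F &, injective start}.
  move=> r r' rF r'F /(congr1 val) /= e; apply/eqP; apply: contraT => nrr'.
  have heads : block B (u r) = block B (u r').
    have bm z : block B z = block B z %% #|B| by rewrite /block modn_mod.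
    have e1 := block_oc B (departure l r) (u r); have e2 := block_oc B (departure l r') (u r').
    rewrite -/(trace l u B r) FE // e in e1; rewrite -/(trace l u B r') FE // in e2.
    by rewrite bm [RHS]bm -e1 -e2.
  have := eq_block heads; rewrite card_bullets_between_heads // family_card => -[] h; exfalso.
    have := cards0_eq h => /setP/(_ r'); rewrite in_set0 in_setI r'F in_set.
    rewrite in_setD1 mem_cint_cc leqnn andbT => /negbFE/eqP/(head_inj hA) e'.
    by rewrite e' eqxx in nrr'.
  have : #|F :\ r| < s by rewrite -card_family_rows [X in _ < X](cardsD1 r) rF.
  rewrite ltnNge -h => /negP; apply; apply: subset_leq_card; apply/subsetP=> i.
  rewrite in_setI in_set in_setD1 in_setD1 => /andP[-> /andP[ne _]]; rewrite andbT.
  by apply: contraNneq ne => ->.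
have /eqP full : start @: F == setT.
  by rewrite eqEcard subsetT card_in_imset // card_family_rows cardsT card_ord leqnn.
have : Ordinal ts \in start @: F by rewrite full inE.
by case/imsetP=> r rF /(congr1 val) /= ->; exists r => //; apply: FE.
Qed.

End Family.

(** * Order inside a block *)

Section BlockOrder.
Variables (n : nat) (B : {set 'I_n}).
Implicit Types x y v w b j : 'I_n.

Lemma card_oc_compl x y : x != y -> #|B :&: cint_oc x y| + #|B :&: cint_oc y x| = #|B|.
Proof.
move=> ne; have := card_oc_rank B x y; have := card_oc_rank B y x.
have : x != y :> nat by [].
move: #|_ :&: _| #|_ :&: _| #|B| (rank _ _) (rank _ _) => c1 c2 s r1 r2.
by case: (ltngtP x y) => //; lia.
Qed.

Lemma block_comparable x y : block B x = block B y ->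
  #|B :&: cint_oc x y| = 0 \/ #|B :&: cint_oc y x| = 0.
Proof.
case: (eqVneq x y) => [->|ne] e.
  by left; rewrite cint_ocxx setI0 cards0.
by have := card_oc_compl ne; have [->|->] := eq_block e; [left | right; lia].
Qed.

Lemma block_empty x y : 0 < #|B| -> #|B :&: cint_oc x y| = 0 -> block B x = block B y.
Proof.
move=> B0 h; have := block_oc B x y; rewrite h add0n.
by rewrite !modn_small // ltn_mod.
Qed.

Lemma block_cshift x y k : 0 < #|B| -> #|B :&: cint_oc x y| = 0 -> k <= cdist x y ->
  block B (cshift x k) = block B x.
Proof.
move=> B0 h le; symmetry; apply: block_empty => //; apply/eqP.
rewrite -leqn0 -h; apply: subset_leq_card; apply: setIS; apply/subsetP=> j.
rewrite !in_setD1 !mem_cint_cc cdist_cshift ?(leq_ltn_trans le) ?cdist_lt //.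
by case/andP=> -> /leq_trans; apply.
Qed.

(** The element b of B in a block is its first vertex, so distance from b orders
    the block. *)
Lemma block_first b v w : b \in B -> block B b = block B v -> block B v = block B w ->
  cdist b v <= cdist b w -> #|B :&: cint_oc v w| = 0.
Proof.
move=> bB ebv ebw le.
have h : #|B :&: cint_oc b w| = 0.
  case: (eq_block (etrans ebv ebw)) => // /eqP; rewrite eqn_leq => /andP[_].
  rewrite leqNgt => /negP[]; apply: proper_card; apply/properP; split; first exact: subsetIl.
  by exists b => //; rewrite in_setI in_setD1 eqxx andbF.
apply/eqP; rewrite -leqn0 -h; apply: subset_leq_card; apply: setIS; apply/subsetP=> j.
have ltb := ltn_ord b; have ltv := ltn_ord v; have ltw := ltn_ord w; have ltj := ltn_ord j.
move: le; rewrite !cint_ocE !cdistE.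
by case: (leqP b v); case: (leqP b w); case: (leqP v w); lia.
Qed.

End BlockOrder.

(** * Walks of short arcs *)

Section Walks.
Variables (m n : nat) (l u : 'I_m -> 'I_n).
Implicit Types (v w x : 'I_n) (c : seq (farc m n)).

Fixpoint walk v c w : bool :=
  if c is e :: c' then (farc_tail l e == v) && walk (farc_head u e) c' w else v == w.

Lemma walk_cat v c1 x c2 w : walk v c1 x -> walk x c2 w -> walk v (c1 ++ c2) w.
Proof.
elim: c1 v => [|e c1 IH] v /=; first by move/eqP->.
by case/andP=> -> /IH h /h ->.
Qed.

(** Walks, unlike circuits, can be concatenated. *)
Lemma walk_circuit v c : walk v c v -> c != [::] -> uniq (map (farc_tail l) c) ->
  circuit l u c.
Proof.
move=> wc c0 uc; split=> //; case: c wc c0 {uc} => // e c /= /andP[te wc] _.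
rewrite -(eqP te) in wc; elim: c {1 3}e wc => [|e' c IH] f /=; first by rewrite eq_sym => ->.
by case/andP=> /eqP-> /IH ->; rewrite eqxx.
Qed.

Definition fwd_walk v d : seq (farc m n) := [seq FwdArc (cshift v k.+1) | k <- iota 0 d].
Definition rev_walk v d : seq (farc m n) := rev [seq RevArc (cshift v k.+1) | k <- iota 0 d].

Lemma iotaS_rcons d : iota 0 d.+1 = rcons (iota 0 d) d.
Proof. by rewrite -addn1 iotaD cats1. Qed.

Lemma walk_fwd_walk v d : walk v (fwd_walk v d) (cshift v d).
Proof.
elim: d => [|d IH]; first by rewrite /= eqxx.
rewrite /fwd_walk iotaS_rcons map_rcons -cats1; apply: walk_cat IH _.
by rewrite /= ordSK !eqxx.
Qed.

Lemma walk_rev_walk v d : walk (cshift v d) (rev_walk v d) v.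
Proof.
elim: d => [|d IH]; first by rewrite /= eqxx.
by rewrite /rev_walk iotaS_rcons map_rcons rev_rcons /= eqxx ordSK.
Qed.

Lemma cshift_inj v k k' : cshift v k = cshift v k' -> k < n -> k' < n -> k = k'.
Proof. by move=> /(congr1 (cdist v)) + lt lt'; rewrite !cdist_cshift. Qed.

Lemma tails_fwd_walk v d : map (farc_tail l) (fwd_walk v d) = [seq cshift v k | k <- iota 0 d].
Proof. by rewrite -map_comp; apply: eq_map => k /=; rewrite ordSK. Qed.

Lemma tails_rev_walk v d : map (farc_tail l) (rev_walk v d) = rev [seq cshift v k.+1 | k <- iota 0 d].
Proof. by rewrite map_rev -map_comp. Qed.

(** One of the two vertices comes first in the block, so the short arcs between
    them, forward or reverse, stay in it.  The last clause prepares the proof that there are no bad arcs: the tail of a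
    forward arc lies in the block strictly before w. *)
Lemma short_walk (B : {set 'I_n}) v w : 0 < #|B| -> block B v = block B w ->
  exists c, [/\ walk v c w, uniq (map (farc_tail l) (c)), w \notin map (farc_tail l) c
    & {in c, forall e, [/\ ~~ is_row_arc e, block B (farc_tail l e) = block B w,
        forall j, e = RevArc j -> j \notin B
      & forall j, e = FwdArc j -> [/\ j \notin B, ord_pred j != w
          & #|B :&: cint_oc (ord_pred j) w| = 0]]}].
Proof.
move=> B0 e; have notinB x y k : #|B :&: cint_oc x y| = 0 -> k < cdist x y -> cshift x k.+1 \notin B.
  move=> h lt; apply/negP => kB; have /eqP := h; rewrite cards_eq0 => /eqP/setP/(_ (cshift x k.+1)).
  rewrite in_setI in_set0 kB in_setD1 mem_cint_cc.
  have ltn := leq_ltn_trans lt (cdist_lt x y); rewrite cdist_cshift // lt andbT => /negbT.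
  rewrite negbK => /eqP /(congr1 (cdist x)); rewrite cdist_cshift //.
  by rewrite cdistE leqnn subnn.
case: (block_comparable e) => h.
- exists (fwd_walk v (cdist v w)); rewrite tails_fwd_walk; have dn := cdist_lt v w; split.
  + by rewrite -{2}(cshift_cdist v w); apply: walk_fwd_walk.
  + rewrite map_inj_in_uniq ?iota_uniq // => k k'; rewrite !mem_iota => lt lt'.
    by move/cshift_inj; apply; lia.
  + apply/mapP => -[k]; rewrite mem_iota => lt; rewrite -{1}(cshift_cdist v w) => /cshift_inj; lia.
  move=> _ /mapP[k + ->]; rewrite mem_iota add0n => /andP[_ lt]; split=> //=.
    by rewrite ordSK -e (block_cshift B0 h) // ltnW.
  move=> _ [<-]; rewrite ordSK; split; first exact: notinB lt.
    by apply/eqP; rewrite -(cshift_cdist v w) => /cshift_inj; lia.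
  apply/eqP; rewrite -leqn0 -h; apply: subset_leq_card; apply: setIS; apply/subsetP=> j.
  have ltv := ltn_ord v; have ltw := ltn_ord w; have ltj := ltn_ord j.
  have : cdist v (cshift v k) <= cdist v w by rewrite cdist_cshift; lia.
  have := ltn_ord (cshift v k); move: (cshift v k) => x; rewrite !cint_ocE !cdistE.
  by case: (leqP v x); case: (leqP x w); case: (leqP v w); lia.
exists (rev_walk w (cdist w v)); rewrite tails_rev_walk; have dn := cdist_lt w v; split.
- by rewrite -{1}(cshift_cdist w v); apply: walk_rev_walk.
- rewrite rev_uniq map_inj_in_uniq ?iota_uniq // => k k'; rewrite !mem_iota => lt lt' /cshift_inj; lia.
- rewrite mem_rev; apply/mapP => -[k]; rewrite mem_iota => lt.
  by rewrite -{1}[w]/(cshift w 0) => /cshift_inj; lia.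
move=> e'; rewrite mem_rev => /mapP[k + ->]; rewrite mem_iota add0n => /andP[_ lt]; split=> //.
  by rewrite /farc_tail (block_cshift B0 h).
by move=> _ [<-]; apply: notinB lt.
Qed.

End Walks.

(** * From a minor to a family of circuits *)

Lemma uniq_flatten_key (T : eqType) (f : nat -> seq T) (key : T -> nat) (g : nat -> nat) r :
  uniq r -> {in r &, injective g} -> {in r, forall k, uniq (f k)} ->
  {in r, forall k, {in f k, forall x, key x = g k}} -> uniq (flatten (map f r)).
Proof.
elim: r => //= k r IH /andP[kr ur] gI fU fK; rewrite cat_uniq fU ?mem_head //= IH //.
- rewrite andbT; apply/hasPn => x /flattenP[_ /mapP[k' k'r ->] xk'].
  apply: contra kr => xk; suff -> : k = k' by [].
  apply: gI; rewrite ?mem_head // ?inE ?k'r ?orbT //.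
  by rewrite -(fK k _ x) ?mem_head // (fK k') // inE k'r orbT.
- by move=> k1 k2 r1 r2; apply: gI; rewrite inE ?r1 ?r2 orbT.
- by move=> k' k'r; apply: fU; rewrite inE k'r orbT.
- by move=> k' k'r; apply: fK; rewrite inE k'r orbT.
Qed.

Section Construction.
Variables (m n : nat) (A : 'M[bool]_(m, n)) (l u : 'I_m -> 'I_n) (s p : nat).
Hypotheses (hA : circular A l u) (m2 : 1 < m) (p2 : 1 < p) (ps : p < s).
Variable B : {set 'I_n}.
Hypothesis hB : circulant_trace l u s p B.

Let a := gcdn s p.

(** By [head_jumped], the first row to depart in a block also ends first among
    those departing there, so that its trace is not larger than that of a row of
    size p which starts in the same block. *)
Lemma first_departure t : t < s -> exists r,
  [/\ block B (departure l r) = t, #|trace l u B r| = p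
    & forall r', block B (departure l r') = t ->
        #|B :&: cint_oc (departure l r) (departure l r')| = 0].
Proof.
case: hB => sB geB exB ts.
have [b bB bt] : exists2 b, b \in B & block B b = t by apply: block_enum_val; rewrite sB.
have [r0 tr0 e0] := exB t ts.
have P0 : block B (departure l r0) == t by apply/eqP.
case: (arg_minnP (P := fun r => block B (departure l r) == t)
  (fun r => cdist b (departure l r)) P0) => r /eqP er minr.
have first r' : block B (departure l r') = t ->
    #|B :&: cint_oc (departure l r) (departure l r')| = 0.
  by move=> e'; apply: (block_first bB); rewrite ?bt ?er ?e' //; apply: minr; rewrite e'.
exists r; split=> //; apply/eqP; rewrite eqn_leq geB andbT -tr0.
have h0 := first r0 e0; have := geB r.
rewrite /trace /jumped /farc_tail /farc_head -!/(departure l _).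
set x := departure l r in h0 *; set x0 := departure l r0 in h0 *.
set y := u r; set y0 := u r0 => gep.
have ltx := ltn_ord x; have ltx0 := ltn_ord x0; have lty := ltn_ord y; have lty0 := ltn_ord y0.
have lt : cdist x x0 < cdist x y.
  rewrite ltnNge; apply/negP => le.
  suff : #|B :&: cint_oc x y| <= #|B :&: cint_oc x x0| by rewrite h0; lia.
  apply/subset_leq_card/setIS/subsetP => j; rewrite !in_setD1 !mem_cint_cc.
  by case/andP=> -> /leq_trans; apply.
have : l r0 \in jumped l u r.
  rewrite -(ord_predK (l r0)) -/(departure l r0) -/x0.
  rewrite /jumped /farc_tail /farc_head -/(departure l r) -/x -/y.
  move: lt; rewrite !cdistE cint_ocE val_ordS.
  by case: (leqP x x0); case: (leqP x y); case: eqP; lia.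
rewrite -(head_jumped hA m2) /jumped /farc_tail /farc_head -/(departure l r0) -/x0 -/y -/y0 => yin.
apply: subset_leq_card; apply/subsetP=> j; rewrite !in_setI => /andP[jB jxy]; rewrite jB /=.
(* No element of B lies between the two departures x and x0. *)
have jx0 : j \notin cint_oc x x0.
  apply/negP => jx; have /eqP := h0; rewrite cards_eq0 => /eqP/setP/(_ j).
  by rewrite in_setI jB jx in_set0.
have ltj := ltn_ord j.
move: lt yin jx0 jxy; rewrite !cdistE !cint_ocE.
by case: (leqP x x0); case: (leqP x y); case: (leqP x0 y0); lia.
Qed.

(** The part of a circuit from the head of the row arc chosen in block t to the
    head of the one chosen in block t + p, to which it goes by short arcs.  All its
    tails lie in block t + p, so segments of different blocks are disjoint. *)
Definition segment (row : 'I_s -> 'I_m) (t : 'I_s) (c : seq (farc m n)) : Prop :=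
  [/\ walk l u (u (row t)) c (u (row (cshift t p))),
      uniq (map (farc_tail l) c),
      {in c, forall e, block B (farc_tail l e) = cshift t p},
      count (@is_row_arc m n) c = 1
    & [/\ forall i, RowArc i \in c -> #|trace l u B i| = p,
          forall j, RevArc j \in c -> j \notin B,
          forall j, FwdArc j \in c -> j \notin B
        & forall r, FwdArc (l r) \notin c]].

Lemma segments : exists row seg, forall t, segment row t (seg t).
Proof.
have [sB geB exB] := hB; have B0 : 0 < #|B| by lia.
have /fin_all_exists[row rowP] : forall t : 'I_s, exists r,
  [/\ block B (departure l r) = t, #|trace l u B r| = p
    & forall r', block B (departure l r') = t ->
        #|B :&: cint_oc (departure l r) (departure l r')| = 0].
  by move=> t; apply: first_departure.
exists row; apply: (fin_all_exists (P := segment row)) => t; have [et tt _] := rowP t.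
have [et' tt' first] := rowP (cshift t p).
have eu : block B (u (row t)) = block B (departure l (row (cshift t p))).
  have := block_oc B (departure l (row t)) (u (row t)).
  rewrite -/(trace l u B (row t)) tt et et' val_cshift /block sB modn_mod => <-.
  by rewrite addnC.
have [c [wc uc nc hc]] := short_walk l u B0 eu.
exists (rcons c (RowArc (row (cshift t p)))).
have row_in i : RowArc i \in rcons c (RowArc (row (cshift t p))) -> i = row (cshift t p).
  by rewrite mem_rcons inE => /orP[/eqP[]|/hc[]].
have in_c e : e \in rcons c (RowArc (row (cshift t p))) -> ~~ is_row_arc e -> e \in c.
  by rewrite mem_rcons inE => /orP[/eqP->|].
split.
- rewrite -cats1; apply: walk_cat wc _; by rewrite /= !eqxx.
- by rewrite map_rcons rcons_uniq nc.
- move=> e; rewrite mem_rcons inE => /orP[/eqP->|/hc[_ -> _ _]]; rewrite -?et' //.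
- rewrite -cats1 count_cat /= addn0 (_ : count _ c = 0) //.
  by apply/eqP; rewrite -leqn0 leqNgt -has_count; apply/hasPn => e /hc[].
split.
- by move=> i /row_in->.
- by move=> j /in_c/(_ isT)/hc[_ _ h _]; apply: h.
- by move=> j /in_c/(_ isT)/hc[_ _ _ h]; case: (h j erefl).
(* A row departing from the tail of a forward arc would depart before the first. *)
move=> r; apply/negP => /in_c/(_ isT)/hc[_ er _ h].
have [_ ne h0] := h _ erefl; have h1 := first r (etrans er et').
by have := card_oc_compl B ne; rewrite h0 h1; lia.
Qed.

(** The orbits of adding p in Z / s have s / gcd(s, p) elements. *)
Lemma step_inj i k k' : k < s %/ a -> k' < s %/ a ->
  i + k * p + p = i + k' * p + p %[mod s] -> k = k'.
Proof.
have a0 : 0 < a by rewrite gcdn_gt0; lia.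
have sE : s = s %/ a * a by rewrite divnK // dvdn_gcdl.
have pE : p = p %/ a * a by rewrite divnK // dvdn_gcdr.
have co : coprime (s %/ a) (p %/ a).
  by rewrite /coprime -(eqn_pmul2r a0) muln_gcdl -sE -pE mul1n.
have main k1 k2 : k1 <= k2 -> k2 < s %/ a ->
    i + k1 * p + p = i + k2 * p + p %[mod s] -> k1 = k2.
  move=> le lt /eqP; rewrite eqn_modDr eqn_modDl eq_sym eqn_mod_dvd ?leq_mul //.
  rewrite -mulnBl {1}sE {1}pE mulnA dvdn_pmul2r // Gauss_dvdl //.
  by move=> /dvdn_leq; lia.
move=> lt lt' e; case: (leqP k k') => [le|/ltnW le]; first exact: main.
by apply/esym/main.
Qed.

(** The i-th circuit chains the segments of blocks i, i + p, i + 2p, ..., which are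
    the blocks of residue i modulo a. *)
Lemma circulant_trace_family : exists G : 'I_(gcdn s p) -> seq (farc m n), good_family l u G.
Proof.
have [row [seg segP]] := segments; have [sB geB exB] := hB.
have a0 : 0 < a by rewrite gcdn_gt0; lia.
have s0 : 0 < s by lia.
have as_ : a <= s by apply: dvdn_leq; rewrite ?dvdn_gcdl.
have qp : s %/ a * p = s * (p %/ a).
  by rewrite muln_divCA_gcd mulnC.
pose at_ (i : 'I_a) k := cshift (widen_ord as_ i) (k * p).
have val_at i k : at_ i k = (i + k * p) %% s :> nat by rewrite val_cshift.
have at_S i k : cshift (at_ i k) p = at_ i k.+1.
  by apply: val_inj; rewrite /= val_cshift !val_at modnDml mulSn [p + _]addnC addnA.
pose circ i q := flatten [seq seg (at_ i k) | k <- iota 0 q].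
have circ_in i q e : e \in circ i q -> exists2 k, k < q & e \in seg (at_ i k).
  by case/flattenP=> _ /mapP[k + ->]; rewrite mem_iota => lt; exists k.
have circ_walk i q : walk l u (u (row (at_ i 0))) (circ i q) (u (row (at_ i q))).
  elim: q => [|q IH]; first by rewrite /= eqxx.
  rewrite /circ iotaS_rcons map_rcons flatten_rcons; apply: walk_cat IH _.
  by rewrite -at_S; case: (segP (at_ i q)).
have circ_count i q : count (@is_row_arc m n) (circ i q) = q.
  elim: q => // q IH; rewrite /circ iotaS_rcons map_rcons flatten_rcons count_cat -/(circ i q) IH.
  by case: (segP (at_ i q)) => _ _ _ -> _; rewrite addn1.
have circ_key i q e : e \in circ i q -> block B (farc_tail l e) %% a = i.
  case/circ_in=> k _; case: (segP (at_ i k)) => _ _ h _ _ /h->.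
  rewrite at_S val_at modn_dvdm ?dvdn_gcdl // -modnDmr.
  by rewrite -modnMmr (eqP (dvdn_gcdr s p : p %% a == 0)) muln0 mod0n addn0 modn_small.
have circ_uniq i : uniq (map (farc_tail l) (circ i (s %/ a))).
  rewrite /circ map_flatten -map_comp.
  apply: (uniq_flatten_key (key := block B) (g := fun k => at_ i k.+1)); first exact: iota_uniq.
  - move=> k k'; rewrite !mem_iota !add0n => /andP[_ lt] /andP[_ lt'].
    rewrite !val_at => e; apply: (step_inj (i := i) lt lt').
    by rewrite -!addnA ![_ * p + p]addnC -!mulSn.
  - by move=> k _ /=; case: (segP (at_ i k)).
  - move=> k _ x /= /mapP[e ek ->]; case: (segP (at_ i k)) => _ _ h _ _.
    by rewrite h // at_S.
pose G i := circ i (s %/ a).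
have q0 : 0 < s %/ a by rewrite divn_gt0.
have G_circuit i : circuit l u (G i).
  apply: (@walk_circuit _ _ _ _ (u (row (at_ i 0)))); last exact: circ_uniq.
  - have e : at_ i 0 = at_ i (s %/ a).
      apply: ord_inj; rewrite (val_at i 0) (val_at i (s %/ a)) qp.
      by rewrite addn0 addnC mulnC modnMDl.
    by rewrite {2}e; apply: circ_walk.
  - by apply: contraTneq q0 => Gi; rewrite -(circ_count i (s %/ a)) -/(G i) Gi.
have G_rows i : #|circuit_rows (G i)| = s %/ a by rewrite (card_circuit_rows (G_circuit i)) circ_count.
have n1 := n_gt1 hA m2.
have G_circle i j : j \in circles (G i) -> j \notin B /\ forall r, l r != j.
  rewrite inE => /circ_in[k _ fk]; case: (segP (at_ i k)) => _ _ _ _ [_ _ h h'].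
  by split; [exact: h | move=> r; apply: contraNneq (h' r) => ->].
have G_cross i j : j \in crosses (G i) -> j \notin B.
  by rewrite inE => /circ_in[k _ fk]; case: (segP (at_ i k)) => _ _ _ _ [_ h _ _]; apply: h.
have G_winding i : winding l u (G i) = Posz (p %/ a).
  have fl b : b \in B -> Posz (jump_count l u (G i) b) = winding l u (G i).
    move=> bB; rewrite -(flow_winding (G_circuit i) b) /flow.
    have /negPf-> : b \notin circles (G i) by apply/negP => /G_circle[]; rewrite bB.
    have /negPf-> : b \notin crosses (G i) by apply/negP => /G_cross; rewrite bB.
    by rewrite addn0 subr0.
  (* Sum over B, row by row: each of the s / a rows jumps over p elements of B. *)
  have : (\sum_(b in B) winding l u (G i) = Posz (s * (p %/ a)))%R.
    under eq_bigr => b bB do rewrite -(fl b bB).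
    rewrite -(big_morph Posz PoszD erefl) sum_jump_count; congr Posz.
    rewrite -qp -(G_rows i) -sum_nat_const; apply: eq_bigr => r.
    rewrite inE => /circ_in[k _ rk]; rewrite setIC; case: (segP (at_ i k)) => _ _ _ _ [h _ _ _].
    exact: h rk.
  rewrite sumr_const sB -mulr_natl natz PoszM => /mulfI; apply; lia.
exists G; split.
- split=> // i i' ne; rewrite -setI_eq0; apply/eqP/setP=> v; rewrite in_set0 in_setI.
  apply/negP => /andP[]; rewrite !inE => /mapP[e /circ_key ei ->] /mapP[e' /circ_key ei' eq].
  by case/eqP: ne; apply: val_inj; rewrite /= -ei -ei' eq.
- move=> r [i]; rewrite /bad_arc.
  have := jumped_essential_bullets hA m2 r (G_circuit i).
  rewrite G_rows setIC => /(_ q0).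
  have /negPf-> : l r \notin circles (G i) by apply/negP => /G_circle[_ /(_ r)]; rewrite eqxx.
  move: #|_ :&: _| (winding _ _ _) => b w; lia.
- by move=> i; split; [apply: circ_count | apply: G_winding].
Qed.

End Construction.

Theorem theorem4p7 (m n : nat) (A : 'M[bool]_(m, n)) (l u : 'I_m -> 'I_n)
    (hA : circular A l u) (s p : nat) (hsp : (2 <= p <= s - 1)%N) :
  ((exists N : {set 'I_n}, mx_iso (minor A N) (circulant s p)) <->
   (exists G : 'I_(gcdn s p) -> seq (farc m n), good_family l u G)) /\
  (forall G : 'I_(gcdn s p) -> seq (farc m n), good_family l u G ->
     mx_iso (minor A (~: family_essential_bullets l G)) (circulant s p)).
Proof.
have [p2 ps] : 1 < p /\ p < s by lia.
have family_minor (G : 'I_(gcdn s p) -> seq (farc m n)) : good_family l u G ->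
    mx_iso (minor A (~: family_essential_bullets l G)) (circulant s p).
  move=> hG; apply: (circulant_trace_iso hA p2 ps (family_m_gt1 p2 ps hG)).
  by rewrite setCK; apply: (family_circulant_trace hA p2 ps hG).
split=> //; split=> [[N /(iso_circulant_trace hA p2 ps)[m2 hB]]|[G hG]].
  exact (circulant_trace_family hA m2 p2 ps hB).
by exists (~: family_essential_bullets l G); apply: family_minor.
Qed.
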